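(* Let $\mathcal{K}=\mathbb{Q}(\sqrt{-7})$ and let $\mathcal{O}_7=\mathbb{Z}[\omega_7]$, where $\omega_7=\frac{1}{2}(1+i\sqrt{7})$, be the ring of integers of $\mathcal{K}$. Then the group $PU(2,1;\mathcal{O}_7)$ is generated by the elements $$I_0=\begin{bmatrix}0&0&1\\0&-1&0\\1&0&0\end{bmatrix},\quad R_1=\begin{bmatrix}1&0&0\\0&-1&0\\0&0&1\end{bmatrix},\quad R_2=\begin{bmatrix}1&1&-\bar{\omega}_7\\0&-1&1\\0&0&1\end{bmatrix},$$ $$R_3=\begin{bmatrix}1&\bar{\omega}_7&-1\\0&-1&\omega_7\\0&0&1\end{bmatrix}\quad\text{and}\quad T=\begin{bmatrix}1&0&i\sqrt{7}\\0&1&0\\0&0&1\end{bmatrix}.$$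
   Context: $\mathbb{C}^{2,1}$ is $\mathbb{C}^3$ with the Hermitian form $\langle \mathbf{z},\mathbf{w}\rangle=z_1\bar{w}_3+z_2\bar{w}_2+z_3\bar{w}_1$. $U(2,1)$ is the group of $3\times 3$ complex matrices preserving this form, and $PU(2,1)=U(2,1)/U(1)$, where $U(1)=\{e^{i\theta}I\}$ is the group of scalar unitary matrices. $PU(2,1;\mathcal{O})$ denotes the subgroup of $PU(2,1)$ consisting of classes of matrices in $U(2,1)$ all of whose entries lie in the ring $\mathcal{O}$. Matrices stand for their classes in $PU(2,1)$. *)

(* Defs.v *)
From HB Require Import structures.
From mathcomp Require Import all_boot all_order all_algebra.
From mathcomp Require Import all_classical all_reals all_analysis.
From mathcomp Require Import complex ring.
Set Implicit Arguments.
Unset Strict Implicit.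
Unset Printing Implicit Defensive.
Import Order.TTheory GRing.Theory Num.Theory.
Local Open Scope classical_set_scope.
Local Open Scope complex_scope.
Local Open Scope ring_scope.

(* The coordinates z_1, z_2, z_3 are indexed here by 0, 1, 2 : 'I_3, and z^* is
   Num.conj, which on R[i] is complex conjugation. *)
Definition herm (R : realType) (z w : 'cV[R[i]]_3) : R[i] :=
  z 0 0 * (w 2 0)^* + z 1 0 * (w 1 0)^* + z 2 0 * (w 0 0)^*.

Definition preserves_herm (R : realType) (A : 'M[R[i]]_3) : bool :=
  `[< forall z w : 'cV[R[i]]_3, herm (A *m z) (A *m w) = herm z w >].

Record U21 (R : realType) := MkU21 {
  U21_mx :> 'M[R[i]]_3;
  U21_mxP : preserves_herm U21_mx }.

HB.instance Definition _ (R : realType) := [isSub for @U21_mx R].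
HB.instance Definition _ (R : realType) := [Choice of U21 R by <:].

Lemma forall_I3 (P : 'I_3 -> Prop) : P 0 -> P 1 -> P 2 -> forall i, P i.
Proof.
move=> P0 P1 P2 [[|[|[|//]]] lti3].
- by have -> : Ordinal lti3 = 0 by exact: val_inj.
- by have -> : Ordinal lti3 = 1 by exact: val_inj.
- by have -> : Ordinal lti3 = 2 by exact: val_inj.
Qed.

Lemma sum_I3 (V : nmodType) (F : 'I_3 -> V) :
  \sum_(i < 3) F i = F 0 + F 1 + F 2.
Proof.
rewrite !big_ord_recl big_ord0 addr0 addrA.
by congr (F _ + F _ + F _); apply: val_inj.
Qed.

Lemma mulmx_I3 (S : pzSemiRingType) m n (A : 'M[S]_(m, 3)) (B : 'M[S]_(3, n)) i j :
  (A *m B) i j = A i 0 * B 0 j + A i 1 * B 1 j + A i 2 * B 2 j.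
Proof. by rewrite mxE sum_I3. Qed.

Section GroupU21.
Variable R : realType.
Implicit Types A B C : U21 R.

Lemma herm_U21 A (z w : 'cV[R[i]]_3) :
  herm (U21_mx A *m z) (U21_mx A *m w) = herm z w.
Proof. exact: (asboolW (U21_mxP A)). Qed.

Lemma U21_unitmx A : U21_mx A \in unitmx.
Proof.
set M := U21_mx A.
pose B : 'M[R[i]]_3 := \matrix_(i, j) (M (rev_ord j) (rev_ord i))^*.
suff BM : B *m M = 1%:M by have [] := mulmx1_unit BM.
have r0 : rev_ord 0 = 2 :> 'I_3 by exact: val_inj.
have r1 : rev_ord 1 = 1 :> 'I_3 by exact: val_inj.
have r2 : rev_ord 2 = 0 :> 'I_3 by exact: val_inj.
apply/matrixP => i j.
have cE k l : (M *m (delta_mx k 0 : 'cV_3)) l 0 = M l k.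
  by rewrite -colE mxE.
have := herm_U21 A (delta_mx j 0) (delta_mx (rev_ord i) 0).
rewrite /herm -/M !cE mulmx_I3 !mxE r0 r1 r2 => E.
rewrite [LHS](_ : _ = M 0 j * (M 2 (rev_ord i))^* + M 1 j * (M 1 (rev_ord i))^*
   + M 2 j * (M 0 (rev_ord i))^*); last by ring.
rewrite {}E; move: i j.
apply: forall_I3; apply: forall_I3;
  rewrite ?r0 ?r1 ?r2 ?mxE /= ?rmorph0 ?rmorph1; ring.
Qed.

Lemma preserves_herm1 : preserves_herm (1%:M : 'M[R[i]]_3).
Proof. by apply/asboolP => z w; rewrite !mul1mx. Qed.

Lemma preserves_hermM A B : preserves_herm (U21_mx A *m U21_mx B).
Proof. by apply/asboolP => z w; rewrite -!mulmxA !herm_U21. Qed.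

Lemma preserves_hermV A : preserves_herm (invmx A).
Proof.
apply/asboolP => z w.
by rewrite -(herm_U21 A) !mulmxA mulmxV ?U21_unitmx// !mul1mx.
Qed.

Definition U21_one := MkU21 preserves_herm1.
Definition U21_mul A B := MkU21 (preserves_hermM A B).
Definition U21_inv A := MkU21 (preserves_hermV A).

Lemma U21_mulA : associative U21_mul.
Proof. by move=> A B C; apply: val_inj; rewrite /= mulmxA. Qed.

Lemma U21_mul1 : left_id U21_one U21_mul.
Proof. by move=> A; apply: val_inj; rewrite /= mul1mx. Qed.

Lemma U21_mulr1 : right_id U21_one U21_mul.
Proof. by move=> A; apply: val_inj; rewrite /= mulmx1. Qed.

Lemma U21_mulV : left_inverse U21_one U21_inv U21_mul.
Proof. by move=> A; apply: val_inj; rewrite /= mulVmx ?U21_unitmx. Qed.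

Lemma U21_mulrV : right_inverse U21_one U21_inv U21_mul.
Proof. by move=> A; apply: val_inj; rewrite /= mulmxV ?U21_unitmx. Qed.

HB.instance Definition _ := isGroup.Build (U21 R)
  U21_mulA U21_mul1 U21_mulr1 U21_mulV U21_mulrV.

End GroupU21.

(* U(1) as a set of elements of U(2,1): the scalar matrices e^(it) I. *)
Definition U1 (R : realType) : set (U21 R) :=
  [set A | exists t : R, U21_mx A = (cos t +i* sin t)%:M].

Section ProjectiveGroup.
Variable R : realType.
Implicit Types A B C : U21 R.

Lemma U1_central A B : U1 A -> (A * B = B * A)%g.
Proof. by move=> [t At]; apply: val_inj; rewrite /= At scalar_mxC. Qed.

Lemma U1_1 : U1 (1%g : U21 R).
Proof. by exists 0; rewrite cos0 sin0. Qed.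

Lemma U1_M A B : U1 A -> U1 B -> U1 (A * B)%g.
Proof.
move=> [s As] [t Bt]; exists (s + t); rewrite /= As Bt -scalar_mxM.
by congr (_%:M); rewrite cosD sinD; congr (_ +i* _); ring.
Qed.

Lemma U1_V A : U1 A -> U1 A^-1%g.
Proof.
move=> [t At]; exists (- t).
apply: (can_inj (mulKmx (U21_unitmx A))); rewrite /= mulmxV ?U21_unitmx//.
rewrite At -scalar_mxM; congr (_%:M); rewrite cosN sinN.
apply/eqP; rewrite eq_complex /=; apply/andP; split; apply/eqP; last by ring.
by rewrite -(cos2Dsin2 t); ring.
Qed.

Definition U1_equiv A B : bool := `[< U1 (A * B^-1)%g >].

Lemma U1_equiv_refl : reflexive U1_equiv.
Proof. by move=> A; apply/asboolP; rewrite mulgV; exact: U1_1. Qed.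

Lemma U1_equiv_sym : symmetric U1_equiv.
Proof.
by move=> A B; apply/asboolP/asboolP => /U1_V; rewrite invgM invgK.
Qed.

Lemma U1_equiv_trans : transitive U1_equiv.
Proof.
move=> B A C /asboolP AB /asboolP BC; apply/asboolP.
by rewrite -(mulgVK B A) -mulgA; exact: U1_M.
Qed.

Canonical U1_equiv_rel :=
  EquivRel U1_equiv U1_equiv_refl U1_equiv_sym U1_equiv_trans.

End ProjectiveGroup.

Definition PU21 (R : realType) := {eq_quot (@U1_equiv R)}%qT.
HB.instance Definition _ (R : realType) := Choice.on (PU21 R).
HB.instance Definition _ (R : realType) := EqQuotient.on (PU21 R).

Definition PU21_class (R : realType) (A : U21 R) : PU21 R := (\pi_(PU21 R) A)%qT.

Section GroupPU21.
Variable R : realType.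
Implicit Types (A B : U21 R) (x y z : PU21 R).
Local Notation cl := (@PU21_class R).

Lemma PU21_classP A B : cl A = cl B <-> U1 (A * B^-1)%g.
Proof.
rewrite /PU21_class; split=> [/eqmodP/asboolP // | AB].
by apply/eqmodP/asboolP.
Qed.

Lemma reprPU21K x : cl (repr x) = x.
Proof. exact: reprK. Qed.

Definition PU21_one : PU21 R := cl 1%g.
Definition PU21_mul x y : PU21 R := cl (repr x * repr y)%g.
Definition PU21_inv x : PU21 R := cl (repr x)^-1%g.

Lemma PU21_mulE A B : PU21_mul (cl A) (cl B) = cl (A * B)%g.
Proof.
apply/PU21_classP.
have /PU21_classP hA := reprPU21K (cl A).
have /PU21_classP hB := reprPU21K (cl B).
set a := repr (cl A) in hA *; set b := repr (cl B) in hB *.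
rewrite (_ : (_ / _)%g = ((a * A^-1) * (b * B^-1))%g); first exact: U1_M.
by rewrite -(mulgA a A^-1%g) -(U1_central A^-1%g hB) invgM !mulgA.
Qed.

Lemma PU21_invE A : PU21_inv (cl A) = cl A^-1%g.
Proof.
apply/PU21_classP.
have /PU21_classP/U1_V hA := reprPU21K (cl A).
move: hA; rewrite invgM invgK => hA.
set a := repr (cl A) in hA *.
by rewrite -[in X in U1 X](mulgVK a A) (U1_central a hA) mulKg.
Qed.

Lemma PU21_mulA : associative PU21_mul.
Proof.
move=> x y z; rewrite -(reprPU21K x) -(reprPU21K y) -(reprPU21K z).
by rewrite !PU21_mulE mulgA.
Qed.

Lemma PU21_mul1 : left_id PU21_one PU21_mul.
Proof. by move=> x; rewrite -(reprPU21K x) PU21_mulE mul1g. Qed.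

Lemma PU21_mulr1 : right_id PU21_one PU21_mul.
Proof. by move=> x; rewrite -(reprPU21K x) PU21_mulE mulg1. Qed.

Lemma PU21_mulV : left_inverse PU21_one PU21_inv PU21_mul.
Proof. by move=> x; rewrite -(reprPU21K x) PU21_invE PU21_mulE mulVg. Qed.

Lemma PU21_mulrV : right_inverse PU21_one PU21_inv PU21_mul.
Proof. by move=> x; rewrite -(reprPU21K x) PU21_invE PU21_mulE mulgV. Qed.

HB.instance Definition _ := isGroup.Build (PU21 R)
  PU21_mulA PU21_mul1 PU21_mulr1 PU21_mulV PU21_mulrV.

End GroupPU21.

(* The classes having at least one representative with all entries in O. *)
Definition PU21_over (R : realType) (O : set R[i]) : set (PU21 R) :=
  [set PU21_class A | A in [set A : U21 R | forall i j, O (U21_mx A i j)]].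

Definition subgroup_generated (G : groupType) (S : set G) : set G :=
  smallest [set H : set G | group_closed (mem H)] S.

Definition i_sqrt7 (R : realType) : R[i] := 0 +i* Num.sqrt 7.

Definition omega7 (R : realType) : R[i] := 2^-1 * (1 + i_sqrt7 R).

(* Z[omega7]: the values at omega7 of the polynomials with integer coefficients. *)
Definition O7 (R : realType) : set R[i] :=
  [set (map_poly (intr : int -> R[i]) p).[omega7 R] | p in [set: {poly int}]].

(* The 3 x 3 matrix given by its list of rows. *)
Definition mx3 (S : nmodType) (s : seq (seq S)) : 'M[S]_3 :=
  \matrix_(i, j) (nth [::] s i)`_j.

Section Generators.
Variable R : realType.
Local Notation w7 := (omega7 R).

Definition mxI0 : 'M[R[i]]_3 := mx3
  [:: [:: 0;  0; 1];
      [:: 0; -1; 0];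
      [:: 1;  0; 0]].

Definition mxR1 : 'M[R[i]]_3 := mx3
  [:: [:: 1;  0; 0];
      [:: 0; -1; 0];
      [:: 0;  0; 1]].

Definition mxR2 : 'M[R[i]]_3 := mx3
  [:: [:: 1;  1; - w7^*];
      [:: 0; -1; 1];
      [:: 0;  0; 1]].

Definition mxR3 : 'M[R[i]]_3 := mx3
  [:: [:: 1; w7^*; -1];
      [:: 0; -1; w7];
      [:: 0;  0; 1]].

Definition mxT : 'M[R[i]]_3 := mx3
  [:: [:: 1; 0; i_sqrt7 R];
      [:: 0; 1; 0];
      [:: 0; 0; 1]].

Lemma i_sqrt7C : (i_sqrt7 R)^* = - i_sqrt7 R.
Proof. by apply/eqP; rewrite eq_complex /= oppr0 !eqxx. Qed.

Lemma omega7_add_conj : w7 + w7^* = 1.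
Proof.
rewrite /omega7 rmorphM rmorphD rmorph1 /= fmorphV rmorph_nat i_sqrt7C; field; rewrite ?pnatr_eq0 //.
Qed.

Lemma i_sqrt7_sqr : i_sqrt7 R ^+ 2 = - 7.
Proof.
have s7 : Num.sqrt 7 * Num.sqrt 7 = 7 :> R by rewrite -expr2 sqr_sqrtr.
rewrite expr2 /i_sqrt7; apply/eqP; rewrite eq_complex; simpc.
by rewrite s7 /= andbT; apply/eqP; ring.
Qed.

Lemma omega7_mul_conj : w7 * w7^* = 2.
Proof.
rewrite /omega7 rmorphM rmorphD rmorph1 /= fmorphV rmorph_nat i_sqrt7C.
have -> : 2^-1 * (1 + i_sqrt7 R) * (2^-1 * (1 - i_sqrt7 R))
  = 4^-1 * (1 - i_sqrt7 R ^+ 2) by field; rewrite ?pnatr_eq0.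
by rewrite i_sqrt7_sqr; field; rewrite ?pnatr_eq0.
Qed.

Lemma mx3_mulE (s : seq (seq R[i])) (z : 'cV[R[i]]_3) (i : 'I_3) :
  (mx3 s *m z) i 0 = (nth [::] s i)`_0 * z 0 0 + (nth [::] s i)`_1 * z 1 0
                     + (nth [::] s i)`_2 * z 2 0.
Proof. by rewrite mulmx_I3 !mxE. Qed.

Lemma mxI0_preserves : preserves_herm mxI0.
Proof.
apply/asboolP => z w; rewrite /herm !mx3_mulE /=.
rewrite !(rmorphD, rmorphM, rmorphN, rmorph1, rmorph0) /=; ring.
Qed.

Lemma mxR1_preserves : preserves_herm mxR1.
Proof.
apply/asboolP => z w; rewrite /herm !mx3_mulE /=.
rewrite !(rmorphD, rmorphM, rmorphN, rmorph1, rmorph0) /=; ring.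
Qed.

Lemma mxR2_preserves : preserves_herm mxR2.
Proof.
apply/asboolP => z w; rewrite /herm !mx3_mulE /=.
move: w7 omega7_add_conj => a /(canRL (addKr _)) aC.
rewrite !(rmorphD, rmorphM, rmorphN, rmorph1, rmorph0) /= conjCK aC; ring.
Qed.

Lemma mxR3_preserves : preserves_herm mxR3.
Proof.
apply/asboolP => z w; rewrite /herm !mx3_mulE /=.
move: w7 omega7_mul_conj => a; rewrite mulrC => aC.
rewrite !(rmorphD, rmorphM, rmorphN, rmorph1, rmorph0) /= conjCK; ring: aC.
Qed.

Lemma mxT_preserves : preserves_herm mxT.
Proof.
apply/asboolP => z w; rewrite /herm !mx3_mulE /=.
rewrite !(rmorphD, rmorphM, rmorphN, rmorph1, rmorph0) /= i_sqrt7C; ring.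
Qed.

Definition I0 : U21 R := MkU21 mxI0_preserves.
Definition R1 : U21 R := MkU21 mxR1_preserves.
Definition R2 : U21 R := MkU21 mxR2_preserves.
Definition R3 : U21 R := MkU21 mxR3_preserves.
Definition T : U21 R := MkU21 mxT_preserves.

End Generators.

(* Main.v *)
Require Import Defs.
From mathcomp Require Import all_boot all_order all_algebra.
From mathcomp Require Import all_classical all_reals all_analysis.
From mathcomp Require Import complex ring lra zify.

Local Open Scope classical_set_scope.

(** The generated group contains every matrix A of U(2,1) over O_7, because the
    first column v = (v_0, v_1, v_2) of A can be reduced by a Euclidean descent
    on |v_2|^2, a natural number.

    The generators provide all the Heisenberg translations [heis a x] over O_7:
    R_2 R_1 and R_3 R_1 are translations with a = 1 and a = omega, which span
    O_7, and T accounts for the remaining freedom in x ([heis_generated]).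
    Write p = v_0 / v_2 and u = v_1 / v_2.  A translation moves u within distance
    sqrt (4/7) of 0, the covering radius of the lattice O_7 ([O7_approx]), and
    then brings Im p into the interval from - sqrt 7 / 2 to sqrt 7 / 2.  As v is
    isotropic, Re p = - |u|^2 / 2, so that |p| < 1 unless Im p is near one end
    of the interval.  If |p| < 1, then I_0, which exchanges v_0 and v_2,
    decreases |v_2|.  Near the ends of the interval one has
    |2 p -+ i sqrt 7| < 1 ([spheres_cover]), and the word in [depth_four]
    replaces v_2 by - (2 p -+ i sqrt 7) v_2, which is again smaller.  In
    hyperbolic terms, the isometric spheres of I_0 and of two elements whose
    last row starts with - 2 cover a fundamental domain of the stabilizer of the
    cusp.

    The descent ends with v_2 = 0 ([descent]).  The matrix is then upper
    triangular, and its diagonal entries are units of O_7, that is 1 or -1; up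
    to the scalar -1, trivial in PU(2,1), and the reflection R_1, it is a
    Heisenberg translation ([generated_upper]). *)

(** * Generated subgroups *)

Lemma group_closedP (G : groupType) (S : set G) :
  group_closed (mem S) <->
  [/\ S 1%g, forall x y, S x -> S y -> S (x * y)%g & forall x, S x -> S x^-1%g].
Proof.
split=> [SG|[S1 SM SV]].
  have SM := group_closedM SG; have SV := group_closedV SG.
  split=> [|x y Sx Sy|x Sx].
  - by have := fst SG; rewrite inE.
  - by have := SM x y; rewrite !inE; apply.
  - by have := SV x; rewrite !inE; apply.
by split=> [|x y]; rewrite !inE// => Sx Sy; apply: SM => //; apply: SV.
Qed.

Lemma group_closed_generated (G : groupType) (S : set G) :
  group_closed (mem (subgroup_generated S)).
Proof.
apply/group_closedP; split=> [|x y Sx Sy|x Sx] H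
  [/[dup] HG /group_closedP[H1 HM HV] SH] //.
- by apply: HM; [exact: Sx|exact: Sy].
- by apply: HV; exact: Sx.
Qed.

Section Reduction.
Set Implicit Arguments.
Unset Strict Implicit.
Import Order.TTheory GRing.Theory Num.Theory.
Local Open Scope complex_scope.
Local Open Scope ring_scope.
Variable R : realType.
Local Notation w7 := (omega7 R).
Local Notation s7 := (Num.sqrt 7 : R).
Local Notation O := (@O7 R).
Local Notation cl := (@PU21_class R).

(** * Arithmetic of the ring of integers *)

Lemma conj_omega7 : w7^* = 1 - w7.
Proof. by rewrite -(omega7_add_conj R) addrC addKr. Qed.

(** Integer combinations of 1 and omega absorb multiplication by omega, since
    omega ^ 2 = omega - 2; this turns evaluations of polynomials into pairs of
    coordinates by a Horner induction. *)
Lemma O7P (z : R[i]) : O z <-> exists m n : int, z = m%:~R + n%:~R * w7.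
Proof.
have w7_sqr : w7 * w7 = w7 - 2.
  by rewrite -[2](omega7_mul_conj R) conj_omega7; ring.
split=> [[p _ <-]|[m [n ->]]].
  elim/poly_ind: p => [|p c [m [n IH]]].
    by exists 0, 0; rewrite rmorph0 horner0 mul0r addr0.
  exists (c - 2 * n), (m + n).
  rewrite rmorphD rmorphM /= map_polyX map_polyC /= hornerMXaddC {}IH.
  by rewrite !intrD mulrNz intrM; ring: w7_sqr.
exists (m%:P + n%:P * 'X) => //.
by rewrite rmorphD rmorphM /= map_polyX !map_polyC /= !hornerE.
Qed.

Lemma O7_int (m : int) : O m%:~R.
Proof. by apply/O7P; exists m, 0; rewrite mul0r addr0. Qed.

Lemma O7_omega : O w7.
Proof. by apply/O7P; exists 0, 1; rewrite mul1r add0r. Qed.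

Lemma O7_0 : O 0. Proof. exact: (O7_int 0). Qed.
Lemma O7_1 : O 1. Proof. exact: (O7_int 1). Qed.

Lemma O7D x y : O x -> O y -> O (x + y).
Proof.
move=> /O7P[m [n ->]] /O7P[p [q ->]]; apply/O7P; exists (m + p), (n + q).
by rewrite !intrD; ring.
Qed.

Lemma O7N x : O x -> O (- x).
Proof.
move=> /O7P[m [n ->]]; apply/O7P; exists (- m), (- n).
by rewrite !mulrNz; ring.
Qed.

Lemma O7M x y : O x -> O y -> O (x * y).
Proof.
move=> [p _ <-] [q _ <-]; exists (p * q) => //.
by rewrite rmorphM hornerM.
Qed.

Lemma O7_conj x : O x -> O x^*.
Proof.
move=> /O7P[m [n ->]]; apply/O7P; exists (m + n), (- n).
by rewrite rmorphD rmorphM !rmorph_int /= conj_omega7 intrD mulrNz; ring.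
Qed.

Lemma i_sqrt7E : i_sqrt7 R = w7 - w7^*.
Proof.
by rewrite conj_omega7 /omega7; field.
Qed.

Lemma O7_i_sqrt7 : O (i_sqrt7 R).
Proof.
rewrite i_sqrt7E; apply: O7D; first exact: O7_omega.
by apply: O7N; apply: O7_conj; exact: O7_omega.
Qed.

Lemma sqr_s7 : s7 ^+ 2 = 7.
Proof. by rewrite sqr_sqrtr ?ler0n. Qed.

Lemma s7_gt0 : 0 < s7.
Proof. by rewrite sqrtr_gt0 ltr0n. Qed.

(** Real-valued, so that squared moduli can be compared without going through
    the partial order of the complex numbers. *)
Definition normsq (z : R[i]) : R := complex.Re z ^+ 2 + complex.Im z ^+ 2.

Lemma normsqE (z : R[i]) : z * z^* = (normsq z)%:C.
Proof.
case: z => a b; rewrite /normsq /=; apply/eqP; rewrite eq_complex /=.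
by apply/andP; split; apply/eqP; ring.
Qed.

Lemma normsq_ge0 z : 0 <= normsq z.
Proof. by rewrite addr_ge0 ?sqr_ge0. Qed.

Lemma normsq_eq0 z : (normsq z == 0) = (z == 0).
Proof.
by rewrite /normsq paddr_eq0 ?sqr_ge0// !sqrf_eq0 eq_complex.
Qed.

Lemma normsqM x y : normsq (x * y) = normsq x * normsq y.
Proof. by case: x => a b; case: y => c d; rewrite /normsq /=; ring. Qed.

Lemma normsqN (z : R[i]) : normsq (- z) = normsq z.
Proof. by case: z => a b; rewrite /normsq /= !sqrrN. Qed.

Lemma O7_coord (m n : int) :
  m%:~R + n%:~R * w7
  = (m%:~R + n%:~R / 2) +i* (n%:~R * s7 / 2) :> R[i].
Proof.
have intC (k : int) : k%:~R = k%:~R +i* 0 :> R[i] by rewrite -[LHS](rmorph_int (real_complex R)).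
have -> : w7 = 2^-1 +i* (s7 / 2).
  have half : 2^-1 = 2^-1 +i* 0 :> R[i] by rewrite -[2](rmorph_nat (real_complex R)) -fmorphV.
  rewrite /omega7 half /i_sqrt7; apply/eqP; rewrite eq_complex /=.
  by apply/andP; split; apply/eqP; ring.
rewrite !intC; apply/eqP; rewrite eq_complex /=.
by apply/andP; split; apply/eqP; ring.
Qed.

Lemma normsq_coord (m n : int) :
  normsq (m%:~R + n%:~R * w7) = (m ^+ 2 + m * n + 2 * n ^+ 2)%:~R.
Proof.
have -> : (m ^+ 2 + m * n + 2 * n ^+ 2)%:~R
  = m%:~R ^+ 2 + m%:~R * n%:~R + (1 + s7 ^+ 2) / 4 * n%:~R ^+ 2 :> R.
  by rewrite sqr_s7 !expr2 !intrD !intrM; field.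
by rewrite O7_coord /normsq /=; field.
Qed.

(** The integrality of the norm form makes the descent well founded. *)
Lemma normsq_O7 z : O z -> exists n : nat, normsq z = n%:R.
Proof.
move=> /O7P[m [n ->]]; rewrite normsq_coord.
exists `|(m ^+ 2 + m * n + 2 * n ^+ 2)%R|%N.
rewrite natr_absz ger0_norm //; nia.
Qed.

(** Both norms are natural numbers with product 1, and m^2 + m n + 2 n^2 = 1
    forces n = 0. *)
Lemma O7_unit x y : O x -> O y -> x * y^* = 1 -> x = 1 \/ x = - 1.
Proof.
move=> Ox Oy xy.
have : normsq x = 1.
  have [m xm] := normsq_O7 Ox; have [n yn] := normsq_O7 (O7_conj Oy).
  have : normsq (x * y^*) = 1 by rewrite xy /normsq /=; ring.
  rewrite normsqM xm yn -natrM => /eqP; rewrite pnatr_eq1 muln_eq1 => /andP[/eqP -> _] //.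
move: Ox => /O7P[m [n ->]]; rewrite normsq_coord -[1]mulr1z => /intr_inj mn.
have n0 : n = 0 by nia.
rewrite n0 mul0r addr0; have [-> | ->] : m = 1 \/ m = -1 by nia.
  by left.
by right; rewrite mulrNz.
Qed.

Lemma round_int (x : R) : exists k : int, - (1/2) <= x + k%:~R <= 1 / 2.
Proof.
exists (- Num.floor (x + 1/2)).
have := floor_itv (x + 1/2); rewrite mulrNz intrD => /andP[]; lra.
Qed.

(** The covering radius of O_7: each of the triangles with vertices 0, 1, omega
    and 0, 1, 1 - omega has sides 1, sqrt 2, sqrt 2 and circumradius
    sqrt (4/7).  Rounding both coordinates only gives 11/16, which is too large
    for [spheres_cover]; where it exceeds 4/7, the centre of an adjacent
    rectangle is a better approximation. *)
Lemma O7_approx (u : R[i]) : exists2 a, O a & normsq (u + a) <= 4 / 7.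
Proof.
pose mk (m n : int) := (m%:~R + n%:~R / 2) +i* (n%:~R * s7 / 2) : R[i].
suff [m [n mn]] : exists m n, normsq (u + mk m n) <= 4 / 7.
  by exists (mk m n) => //; apply/O7P; exists m, n; rewrite O7_coord.
have s0 : s7 != 0 by rewrite gt_eqF ?s7_gt0.
have E m n : normsq (u + mk m n) =
   (complex.Re u + n%:~R / 2 + m%:~R) ^+ 2 + 7 * (complex.Im u / s7 + n%:~R / 2) ^+ 2.
  transitivity ((complex.Re u + n%:~R / 2 + m%:~R) ^+ 2
                + s7 ^+ 2 * (complex.Im u / s7 + n%:~R / 2) ^+ 2).
    by rewrite /mk; case: (u) => a b; rewrite /normsq /=; field.
  by rewrite sqr_s7.
have [n] := round_int (2 * (complex.Im u / s7)).
have [m] := round_int (complex.Re u + n%:~R / 2).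
set q := complex.Im u / s7 in E *; set x := complex.Re u + _ + _ => hx hq.
pose y := q + n%:~R / 2.
have hy : - (1/4) <= y <= 1/4 by move: hq; rewrite /y; lra.
have [|small] := boolP (x ^+ 2 + 7 * y ^+ 2 <= 4 / 7); first by exists m, n; rewrite E.
(* Outside the disc, a point a + i sqrt 7 b of the quarter rectangle lies beyond
   the perpendicular bisector a + 7 b = 2 of 0 and omega. *)
have cell (a b : R) : 0 <= a <= 1/2 -> 0 <= b <= 1/4 -> ~~ (a ^+ 2 + 7 * b ^+ 2 <= 4 / 7) ->
    (1/2 - a) ^+ 2 + 7 * (1/2 - b) ^+ 2 <= 4/7.
  move=> ha hb hab.
  have : 2 < a + 7 * b by nra.
  nra.
have {}E m' n' : normsq (u + mk m' n') =
   (x + (n' - n)%:~R / 2 + (m' - m)%:~R) ^+ 2 + 7 * (y + (n' - n)%:~R / 2) ^+ 2.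
  by rewrite E /x /y !intrD !mulrNz; field.
have [x0|x0] := leP 0 x; have [y0|y0] := leP 0 y.
- exists m, (n - 1); rewrite E (_ : n - 1 - n = -1); last by ring.
  rewrite (_ : m - m = 0); last by ring.
  have := cell x y; rewrite mulrNz ?mulr1z; nra.
- exists (m - 1), (n + 1); rewrite E (_ : n + 1 - n = 1); last by ring.
  rewrite (_ : m - 1 - m = -1); last by ring.
  have := cell x (- y); rewrite mulrNz ?mulr1z; nra.
- exists (m + 1), (n - 1); rewrite E (_ : n - 1 - n = -1); last by ring.
  rewrite (_ : m + 1 - m = 1); last by ring.
  have := cell (- x) y; rewrite mulrNz ?mulr1z; nra.
- exists m, (n + 1); rewrite E (_ : n + 1 - n = 1); last by ring.
  rewrite (_ : m - m = 0); last by ring.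
  have := cell (- x) (- y); rewrite ?mulr1z; nra.
Qed.

(** For s = |u|^2 and p = - s / 2 + i sqrt 7 t, the three quantities are |p|^2
    and |2 p -+ i sqrt 7|^2.  With s <= 4/7 the first is below 1 as long as
    7 t^2 < 45/49 and the others as long as 7 (2 |t| - 1)^2 < 33/49; the cut at
    |t| = 9/25 satisfies both. *)
Lemma spheres_cover (s t : R) : 0 <= s <= 4/7 -> - (1/2) <= t <= 1/2 ->
  [\/ s ^+ 2 / 4 + 7 * t ^+ 2 < 1,
      s ^+ 2 + 7 * (2 * t - 1) ^+ 2 < 1 |
      s ^+ 2 + 7 * (2 * t + 1) ^+ 2 < 1].
Proof.
move=> hs ht.
have hs2 : s ^+ 2 <= 16/49 by nra.
have [h|h] := ltP t (-(9/25)); first by apply: Or33; nra.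
have [h'|h'] := ltP (9/25) t; first by apply: Or32; nra.
by apply: Or31; nra.
Qed.

(** * Integral unitary matrices and the generated group *)

Definition over_O7 (A : U21 R) := forall i j, O (U21_mx A i j).

(** The matrix of the form is antidiagonal, so column j pairs to 1 with column
    2 - j and to 0 with the others. *)
Lemma herm_col (A : U21 R) (j k : 'I_3) :
  U21_mx A 0 j * (U21_mx A 2 k)^* + U21_mx A 1 j * (U21_mx A 1 k)^*
  + U21_mx A 2 j * (U21_mx A 0 k)^* = (j == rev_ord k)%:R.
Proof.
have cE (l m : 'I_3) : (U21_mx A *m (delta_mx l 0 : 'cV_3)) m 0 = U21_mx A m l.
  by rewrite -colE mxE.
have := herm_U21 A (delta_mx j 0) (delta_mx k 0).
rewrite /herm !cE !mxE => ->.
by move: j k; do 2 apply: forall_I3; rewrite /= ?rmorph0 ?rmorph1; ring.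
Qed.

Lemma U21_mxV (A : U21 R) i j :
  U21_mx A^-1%g i j = (U21_mx A (rev_ord j) (rev_ord i))^*.
Proof.
pose B : 'M[R[i]]_3 := \matrix_(i, j) (U21_mx A (rev_ord j) (rev_ord i))^*.
suff BA : B *m U21_mx A = 1%:M.
  rewrite -[LHS]/(invmx (U21_mx A) i j) -[invmx _]mul1mx -BA.
  by rewrite mulmxK ?U21_unitmx// mxE.
have [r0 r1 r2] : [/\ rev_ord 0 = 2 :> 'I_3, rev_ord 1 = 1 :> 'I_3
    & rev_ord 2 = 0 :> 'I_3] by split; apply: val_inj.
apply/matrixP => k l; rewrite mulmx_I3 !mxE r0 r1 r2.
have := herm_col A l (rev_ord k); rewrite rev_ordK eq_sym => <-; ring.
Qed.

Lemma over_O7_1 : over_O7 1%g.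
Proof.
by move=> i j; rewrite mxE; case: (i == j); [exact: (O7_int 1)|exact: (O7_int 0)].
Qed.

Lemma over_O7_M A B : over_O7 A -> over_O7 B -> over_O7 (A * B)%g.
Proof.
move=> hA hB i j; rewrite /= mulmx_I3.
by apply: O7D; [apply: O7D|]; apply: O7M.
Qed.

Lemma over_O7_V A : over_O7 A -> over_O7 A^-1%g.
Proof. by move=> hA i j; rewrite U21_mxV; apply: O7_conj. Qed.

Let gens : set (PU21 R) :=
  [set cl (I0 R); cl (R1 R); cl (R2 R); cl (R3 R); cl (T R)]%classic.

(** Integrality is recorded separately: a matrix whose class is generated need
    only be integral up to a unit complex factor. *)
Definition generated (A : U21 R) := over_O7 A /\ subgroup_generated gens (cl A).

Lemma generated_M A B : generated A -> generated B -> generated (A * B)%g.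
Proof.
move=> [A7 Ag] [B7 Bg]; split; first exact: over_O7_M.
rewrite -PU21_mulE -[PU21_mul _ _]/(cl A * cl B)%g.
by have /group_closedP[_ M _] := @group_closed_generated _ gens; apply: M.
Qed.

Lemma generated_V A : generated A -> generated A^-1%g.
Proof.
move=> [A7 Ag]; split; first exact: over_O7_V.
rewrite -PU21_invE -[PU21_inv _]/(cl A)^-1%g.
by have /group_closedP[_ _ V] := @group_closed_generated _ gens; apply: V.
Qed.

Lemma generated_cancel A B : generated A -> generated (A * B)%g -> generated B.
Proof. by move=> /generated_V Ag ABg; rewrite -(mulKg A B); apply: generated_M. Qed.

Lemma generated_1 : generated 1%g.
Proof.
split; first exact: over_O7_1.
by have /group_closedP[h1 _ _] := @group_closed_generated _ gens; exact: h1.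
Qed.

Lemma O7_mx3 (s : seq (seq R[i])) :
  [/\ O (nth [::] s 0)`_0, O (nth [::] s 0)`_1 & O (nth [::] s 0)`_2] ->
  [/\ O (nth [::] s 1)`_0, O (nth [::] s 1)`_1 & O (nth [::] s 1)`_2] ->
  [/\ O (nth [::] s 2)`_0, O (nth [::] s 2)`_1 & O (nth [::] s 2)`_2] ->
  forall i j, O (mx3 s i j).
Proof.
move=> [? ? ?] [? ? ?] [? ? ?].
by do 2 apply: forall_I3; rewrite mxE.
Qed.

Lemma over_O7_gens :
  [/\ over_O7 (I0 R), over_O7 (R1 R), over_O7 (R2 R), over_O7 (R3 R)
    & over_O7 (T R)].
Proof.
have O0 := O7_0; have O1 := O7_1; have ON1 := O7N O1.
have Ow := O7_omega; have Owc := O7_conj Ow; have ONwc := O7N Owc.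
have Oi := O7_i_sqrt7.
by split; apply: O7_mx3; split.
Qed.

Lemma generated_gens :
  [/\ generated (I0 R), generated (R1 R), generated (R2 R), generated (R3 R)
    & generated (T R)].
Proof.
have [h0 h1 h2 h3 hT] := over_O7_gens.
split; split=> //; apply: sub_gen_smallest; rewrite /gens /=; tauto.
Qed.

(** * Heisenberg translations *)

(** Every unipotent upper triangular element of U(2,1) has this form, with
    x + x^* = - |a|^2. *)
Definition heis (a x : R[i]) : 'M[R[i]]_3 := mx3
  [:: [:: 1; - a^*; x];
      [:: 0; 1; a];
      [:: 0; 0; 1]].

Definition heis_in (a x : R[i]) :=
  exists2 A : U21 R, generated A & U21_mx A = heis a x.

Lemma heisM a x b y : heis a x *m heis b y = heis (a + b) (x + y - a^* * b).
Proof.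
apply/matrixP => i j; rewrite mulmx_I3 !mxE; move: i j.
by do 2 apply: forall_I3; rewrite /= ?rmorphD /=; ring.
Qed.

Lemma heis_inM a x b y :
  heis_in a x -> heis_in b y -> heis_in (a + b) (x + y - a^* * b).
Proof.
move=> [A GA Aa] [B GB Bb]; exists (A * B)%g; first exact: generated_M.
by rewrite /= Aa Bb heisM.
Qed.

Lemma heis_inV a x : heis_in a x -> heis_in (- a) x^*.
Proof.
move=> [A GA Aa]; exists A^-1%g; first exact: generated_V.
apply/matrixP => i j; rewrite U21_mxV Aa !mxE; move: i j.
by do 2 apply: forall_I3;
  rewrite /= ?rmorphN ?rmorph1 ?rmorph0 //= ?conjCK ?opprK.
Qed.

Lemma heis_in0 : heis_in 0 0.
Proof.
exists 1%g; first exact: generated_1.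
apply/matrixP => i j; rewrite !mxE; move: i j.
by do 2 apply: forall_I3; rewrite /= ?rmorph0 ?oppr0.
Qed.

Lemma heis_in1 : heis_in 1 (- w7^*).
Proof.
have [_ g1 g2 _ _] := generated_gens; exists (R2 R * R1 R)%g; first exact: generated_M.
apply/matrixP => i j; rewrite /= mulmx_I3 !mxE; move: i j.
by do 2 apply: forall_I3; rewrite /= ?rmorph1; ring.
Qed.

Lemma heis_in_omega : heis_in w7 (- 1).
Proof.
have [_ g1 _ g3 _] := generated_gens; exists (R3 R * R1 R)%g; first exact: generated_M.
apply/matrixP => i j; rewrite /= mulmx_I3 !mxE; move: i j.
by do 2 apply: forall_I3; rewrite /=; ring.
Qed.

Lemma heis_in_T : heis_in 0 (i_sqrt7 R).
Proof.
have [_ _ _ _ gT] := generated_gens; exists (T R) => //.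
apply/matrixP => i j; rewrite !mxE; move: i j.
by do 2 apply: forall_I3; rewrite /= ?rmorph0 ?oppr0.
Qed.

Lemma heis_in_int a (m : int) :
  (exists x, heis_in a x) -> exists x, heis_in (m%:~R * a) x.
Proof.
move=> [x ax]; elim/int_rect: m => [|n [y IH]|n [y IH]].
- by exists 0; rewrite mul0r; exact: heis_in0.
- by eexists; rewrite intS intrD mulrDl mul1r; exact: (heis_inM ax IH).
- eexists; rewrite intS opprD intrD mulrDl mulrNz mulN1r.
  exact: (heis_inM (heis_inV ax) IH).
Qed.

Lemma heis_in_vert (m : int) : heis_in 0 (m%:~R * i_sqrt7 R).
Proof.
have step x y : heis_in 0 x -> heis_in 0 y -> heis_in 0 (x + y).
  by move=> hx hy; have := heis_inM hx hy; rewrite mulr0 subr0 addr0.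
elim/int_rect: m => [|n IH|n IH].
- by rewrite mul0r; exact: heis_in0.
- by rewrite intS intrD mulrDl mul1r; apply: step IH; exact: heis_in_T.
- rewrite intS opprD intrD mulrDl mulrNz mulN1r; apply: step IH.
  by have := heis_inV heis_in_T; rewrite oppr0 i_sqrt7C.
Qed.

(** The words in R_2 R_1 and R_3 R_1 realize every a in O_7 with some corner entry
    y; then x - y lies in O_7 and is purely imaginary, hence an integer multiple
    of i sqrt 7, which a power of T corrects. *)
Lemma heis_generated a x : O a -> O x -> x + x^* = - (a * a^*) -> heis_in a x.
Proof.
move=> Oa Ox xa.
have [y ay] : exists y, heis_in a y.
  move: Oa => /O7P[m [n ->]].
  have [|y hy] := @heis_in_int 1 m; first by exists (- w7^*); exact: heis_in1.
  have [|z hz] := @heis_in_int w7 n; first by exists (- 1); exact: heis_in_omega.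
  by eexists; rewrite -[m%:~R]mulr1; exact: (heis_inM hy hz).
have [k dk] : exists k : int, x - y = k%:~R * i_sqrt7 R.
  have [A [OA _] Aa] := ay.
  have Oy : O y by have := OA 0 2; rewrite Aa mxE.
  have ya : y + y^* = - (a * a^*).
    have := herm_col A 2 2; rewrite Aa !mxE /= rmorph1 mulr1 mul1r => E.
    by apply/eqP; rewrite -subr_eq0 opprK; apply/eqP; apply: etrans E; ring.
  have /O7P[m [n dE]] := O7D Ox (O7N Oy).
  have d0 : (m * 2 + n)%:~R = 0 :> R[i].
    have : (x - y) + (x - y)^* = 0.
      by rewrite rmorphB addrACA -opprD xa ya subrr.
    rewrite dE rmorphD rmorphM !rmorph_int /= conj_omega7 intrD intrM => <-; ring.
  move: d0 => /eqP; rewrite intr_eq0 => /eqP mn.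
  exists (- m); rewrite dE i_sqrt7E conj_omega7.
  by rewrite (_ : n = - (m * 2)); [rewrite !mulrNz intrM; ring | lia].
have := heis_inM (heis_in_vert k) ay.
by rewrite -dk rmorph0 mul0r subr0 add0r subrK.
Qed.

Lemma heis_mulE a x (v : 'cV[R[i]]_3) :
  [/\ (heis a x *m v) 0 0 = v 0 0 - a^* * v 1 0 + x * v 2 0,
      (heis a x *m v) 1 0 = v 1 0 + a * v 2 0 &
      (heis a x *m v) 2 0 = v 2 0].
Proof. by split; rewrite mx3_mulE /=; ring. Qed.

Lemma I0_mulE (v : 'cV[R[i]]_3) :
  [/\ (I0 R *m v) 0 0 = v 2 0, (I0 R *m v) 1 0 = - v 1 0 &
      (I0 R *m v) 2 0 = v 0 0].
Proof. by split; rewrite mx3_mulE /=; ring. Qed.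

(** * Descent on the last coordinate *)

(** The point (i sqrt 7, 0, 2) has last coordinate of squared norm 4, but the
    translation by a = 1 with x = - omega brings it to (-1, 2, 2), which I_0 maps
    to (2, -2, -1); the translation by a = -2 moves that to (0, 0, -1), and I_0
    ends at infinity, so the last row of this word vanishes on (i sqrt 7, 0, 2).
    Its complex conjugate is treated alike with x = - omega^*. *)
Lemma depth_four x : O x -> x + x^* = - 1 ->
  exists2 A : U21 R, generated A &
    forall v : 'cV_3, (A *m v) 2 0 = - (2 * v 0 0 + (1 + 2 * x) * v 2 0).
Proof.
move=> Ox xx; have [g0 _ _ _ _] := generated_gens.
have [|B GB Bx] := heis_generated (O7_1) Ox; first by rewrite rmorph1 mulr1.
have [|C GC Cx] := heis_generated (O7_int (-2)) (O7_int (-2)).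
  by rewrite rmorph_int -intrM -intrD.
exists (I0 R * C * I0 R * B)%g; first by do ! apply: generated_M.
move=> v; rewrite /= -!mulmxA.
have [_ _ ->] := I0_mulE (U21_mx C *m (mxI0 R *m (U21_mx B *m v))).
rewrite Cx; have [-> _ _] := heis_mulE (-2)%:~R (-2)%:~R (mxI0 R *m (U21_mx B *m v)).
have [-> -> ->] := I0_mulE (U21_mx B *m v).
rewrite Bx; have [-> -> ->] := heis_mulE 1 x v.
by rewrite rmorph_int rmorph1; ring.
Qed.

(** The three regions of [spheres_cover] are handled by I_0 and by
    [depth_four], used with the two values of x for which
    1 + 2 x = -+ i sqrt 7. *)
Lemma descent_reduced (v : 'cV[R[i]]_3) (p u : R[i]) :
  v 0 0 = p * v 2 0 -> v 2 0 != 0 -> p + p^* + u * u^* = 0 ->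
  normsq u <= 4 / 7 -> - (1/2) <= complex.Im p / s7 <= 1/2 ->
  exists2 A : U21 R, generated A & normsq ((A *m v) 2 0) < normsq (v 2 0).
Proof.
move=> v0 v2 iso hu hp.
have [g0 _ _ _ _] := generated_gens.
have n2 : 0 < normsq (v 2 0) by rewrite lt_neqAle normsq_ge0 eq_sym normsq_eq0 v2.
set t := complex.Im p / s7 in hp; set s := normsq u in hu.
have pE : p = (- s / 2) +i* (s7 * t).
  move: iso; rewrite normsqE -/s /t; case: (p) => a b /=.
  move=> /eqP; rewrite eq_complex /= => /andP[/eqP h _].
  rewrite mulrCA divff ?gt_eqF ?s7_gt0// mulr1; congr (_ +i* _).
  by apply/eqP; rewrite -subr_eq0; apply/eqP; move: h; lra.
have lower c : normsq c < 1 -> forall A : U21 R, generated A -> (A *m v) 2 0 = c * v 2 0 ->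
    exists2 A : U21 R, generated A & normsq ((A *m v) 2 0) < normsq (v 2 0).
  by move=> hc A GA cE; exists A => //; rewrite cE normsqM gtr_pMl.
(* The case r = 1 or r = -1 gives the quantities of [spheres_cover]. *)
have two (r : R) : normsq (2 * p + r%:C * i_sqrt7 R) = s ^+ 2 + 7 * (2 * t + r) ^+ 2.
  transitivity (s ^+ 2 + s7 ^+ 2 * (2 * t + r) ^+ 2); last by rewrite sqr_s7.
  by rewrite pE /i_sqrt7 -[2 in LHS](rmorph_nat (real_complex R)) /normsq /=; field.
have s0 : 0 <= s <= 4/7 by rewrite normsq_ge0.
case: (spheres_cover s0 hp) => h.
- apply: (lower p _ _ g0); last by have [_ _ ->] := I0_mulE v.
  rewrite pE /normsq /= [(s7 * t) ^+ 2]exprMn sqr_s7; move: h; lra.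
- have [||A GA AE] := @depth_four (- w7); first exact/O7N/O7_omega.
    by rewrite rmorphN /= conj_omega7; ring.
  apply: (lower (- (2 * p + (-1)%:C * i_sqrt7 R)) _ _ GA).
    by rewrite normsqN two; move: h; lra.
  rewrite AE v0 i_sqrt7E conj_omega7 rmorphN1; ring.
- have [||A GA AE] := @depth_four (- w7^*); first exact/O7N/O7_conj/O7_omega.
    by rewrite rmorphN /= conjCK conj_omega7; ring.
  apply: (lower (- (2 * p + 1%:C * i_sqrt7 R)) _ _ GA).
    by rewrite normsqN two; move: h; lra.
  rewrite AE v0 i_sqrt7E conj_omega7 rmorph1; ring.
Qed.

(** The translation by a, with corner entry - |a|^2 omega + k i sqrt 7, centres u;
    the integer k is still free, and shifts Im p by k sqrt 7. *)
Lemma descent_step (v : 'cV[R[i]]_3) :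
  herm v v = 0 -> v 2 0 != 0 ->
  exists2 A : U21 R, generated A & normsq ((A *m v) 2 0) < normsq (v 2 0).
Proof.
move=> iso v2.
have [a Oa ha] := O7_approx (v 1 0 / v 2 0).
pose p0 := (v 0 0 - a^* * v 1 0) / v 2 0 - a * a^* * w7.
have [k hk] := round_int (complex.Im p0 / s7).
pose x := - (a * a^* * w7) + k%:~R * i_sqrt7 R.
have Ox : O x.
  have Oaa := O7M Oa (O7_conj Oa).
  apply: O7D; first by apply/O7N/O7M => //; exact: O7_omega.
  by apply: O7M; [exact: O7_int|exact: O7_i_sqrt7].
have [|A GA Aa] := heis_generated Oa Ox.
  rewrite /x; move: (w7) (i_sqrt7 R) (conj_omega7) (i_sqrt7C R) => w j wc jc.
  by rewrite rmorphD rmorphN !rmorphM rmorph_int /= conjCK wc jc; ring.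
have [v'0 v'1 v'2] := heis_mulE a x v.
have := @descent_reduced (A *m v) (p0 + k%:~R * i_sqrt7 R) (v 1 0 / v 2 0 + a).
rewrite Aa v'0 v'2 -Aa; case=> //.
- by rewrite /p0 /x; field.
- have := herm_U21 A v v; rewrite iso /herm Aa v'0 v'1 v'2 => E.
  have c2 : (v 2 0)^* != 0 by rewrite conjC_eq0.
  apply: (mulIf v2); apply: (mulIf c2); rewrite !mul0r; apply: etrans E.
  rewrite /p0 /x.
  move: (w7) (i_sqrt7 R) (conj_omega7) (i_sqrt7C R) => w j wc jc.
  rewrite !(rmorphD, rmorphM, rmorphN, fmorphV, rmorph_int) /= !conjCK ?wc ?jc.
  by field; rewrite v2 c2.
- rewrite (_ : complex.Im _ / s7 = complex.Im p0 / s7 + k%:~R) //.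
  have s0 : s7 != 0 by rewrite gt_eqF ?s7_gt0.
  rewrite -[k%:~R in LHS](rmorph_int (real_complex R)).
  by case: (p0) => b c; rewrite /i_sqrt7 /=; field.
move=> B GB lt; exists (B * A)%g; first exact: generated_M.
by rewrite /= -mulmxA.
Qed.

Lemma descent (n : nat) (v : 'cV[R[i]]_3) :
  (forall i, O (v i 0)) -> herm v v = 0 -> normsq (v 2 0) = n%:R ->
  exists2 A : U21 R, generated A & (A *m v) 2 0 = 0.
Proof.
elim/ltn_ind: n v => n IH v Ov iso vn.
have [v2|v2] := eqVneq (v 2 0) 0; first by exists 1%g; [exact: generated_1|rewrite mul1mx].
have [A GA lt] := descent_step iso v2.
have OAv i : O ((A *m v) i 0).
  have [OA _] := GA; rewrite mulmx_I3.
  by apply: O7D; [apply: O7D|]; apply: O7M.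
have [m mE] := normsq_O7 (OAv 2).
have [||||B GB B0] := IH m _ (A *m v) => //.
- by move: lt; rewrite vn mE ltr_nat.
- by rewrite herm_U21.
exists (B * A)%g; first exact: generated_M.
by rewrite /= -mulmxA.
Qed.

(** * The stabilizer of the cusp at infinity *)

(** The scalar -1 = exp (i pi) has trivial class, so signs can be changed freely. *)
Lemma generated_opp1 : exists2 Z : U21 R, generated Z & U21_mx Z = (-1)%:M.
Proof.
have pZ : preserves_herm ((-1)%:M : 'M[R[i]]_3).
  apply/asboolP => z w; rewrite /herm !mul_scalar_mx !mxE !rmorphM !rmorphN1; ring.
exists (MkU21 pZ) => //; split.
  move=> i j; rewrite mxE; case: (i == j); [exact: (O7_int (-1))|exact: (O7_int 0)].
have -> : cl (MkU21 pZ) = cl 1%g.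
  apply/PU21_classP; exists pi; rewrite invg1 mulg1 /= cospi sinpi.
  by congr (_%:M); apply/eqP; rewrite eq_complex /= oppr0 !eqxx.
by have [] := generated_1.
Qed.

(** Orthogonality of the columns kills the entries below the diagonal and makes
    the diagonal entries units; after correcting their signs with the scalar -1
    and R_1, only a Heisenberg translation is left. *)
Lemma generated_upper (A : U21 R) : over_O7 A -> U21_mx A 2 0 = 0 -> generated A.
Proof.
have [_ g1 _ _ _] := generated_gens; have [Z GZ ZE] := generated_opp1.
have colB0 (B : U21 R) : U21_mx B 2 0 = 0 ->
  U21_mx B 1 0 = 0 /\ U21_mx B 0 0 * (U21_mx B 2 2)^* = 1.
  move=> B20.
  have B10 : U21_mx B 1 0 = 0.
    have := herm_col B 0 0.
    rewrite B20 rmorph0 mulr0 mul0r addr0 add0r => /eqP.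
    by rewrite mulf_eq0 conjC_eq0 orbb => /eqP.
  by split=> //; have := herm_col B 0 2; rewrite B10 B20 !mul0r !addr0.
have corner1 (B : U21 R) : over_O7 B -> U21_mx B 2 0 = 0 -> U21_mx B 0 0 = 1 -> generated B.
  move=> OB B20 B00; have [B10 B22] := colB0 B B20.
  have B21 : U21_mx B 2 1 = 0.
    have := herm_col B 0 1; rewrite B00 B10 B20 !mul0r mul1r !addr0 => /eqP.
    by rewrite conjC_eq0 => /eqP.
  have B11 : U21_mx B 1 1 * (U21_mx B 1 1)^* = 1.
    by have := herm_col B 1 1; rewrite B21 rmorph0 mulr0 mul0r addr0 add0r.
  have {}B22 : U21_mx B 2 2 = 1.
    by apply: (can_inj conjCK); rewrite rmorph1 -B22 B00 mul1r.
  have unip (D : U21 R) : over_O7 D -> U21_mx D 0 0 = 1 -> U21_mx D 1 0 = 0 ->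
      U21_mx D 2 0 = 0 -> U21_mx D 2 1 = 0 -> U21_mx D 2 2 = 1 ->
      U21_mx D 1 1 = 1 -> generated D.
    move=> OD D00 D10 D20 D21 D22 D11.
    have D01 : U21_mx D 0 1 = - (U21_mx D 1 2)^*.
      apply/eqP; rewrite -subr_eq0 opprK; apply/eqP; apply: etrans (herm_col D 1 2).
      by rewrite D22 D11 D21 rmorph1; ring.
    have [|C GC CE] := @heis_generated (U21_mx D 1 2) (U21_mx D 0 2) (OD 1 2) (OD 0 2).
      apply/eqP; rewrite -subr_eq0 opprK; apply/eqP; apply: etrans (herm_col D 2 2).
      by rewrite D22 rmorph1; ring.
    suff -> : D = C by [].
    apply: val_inj; rewrite /= CE; apply/matrixP => i j; rewrite mxE; move: i j.
    by do 2 apply: forall_I3.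
  have [B1|B1] := O7_unit (OB 1 1) (OB 1 1) B11; first exact: unip.
  have [g1O _] := g1.
  apply: (generated_cancel g1); apply: unip; first exact: over_O7_M;
    rewrite /= !mulmx_I3 !mxE /= ?(B00, B10, B20, B21, B22, B1); ring.
move=> OA A20; have [A10 A22] := colB0 A A20.
have [A1|A1] := O7_unit (OA 0 0) (OA 2 2) A22; first exact: corner1.
have [ZO _] := GZ.
by apply: (generated_cancel GZ); apply: corner1; first exact: over_O7_M;
  rewrite /= ZE mul_scalar_mx mxE ?A20 ?A1; ring.
Qed.

(** The first column of A is isotropic, and moving it to infinity makes A upper
    triangular. *)
Lemma generated_all (A : U21 R) : over_O7 A -> generated A.
Proof.
move=> OA.
have E i : (col 0 (U21_mx A)) i 0 = U21_mx A i 0 by rewrite mxE.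
have [n nE] := normsq_O7 (OA 2 0).
have [|||B GB B0] := @descent n (col 0 (U21_mx A)).
- by move=> i; rewrite E; exact: OA.
- by apply: etrans (herm_col A 0 0); rewrite /herm !E.
- by rewrite E.
apply: (generated_cancel GB); apply: generated_upper.
  by apply: over_O7_M => //; case: GB.
by rewrite -[RHS]B0 /= !mulmx_I3 !E.
Qed.

End Reduction.

Theorem theorem4p4 (R : realType) :
  PU21_over (@O7 R) =
  subgroup_generated
    [set PU21_class (I0 R); PU21_class (R1 R); PU21_class (R2 R);
         PU21_class (R3 R); PU21_class (T R)].
Proof.
apply/seteqP; split=> [_ [A OA <-]|]; first by have [] := generated_all OA.
have [[h0 _] [h1 _] [h2 _] [h3 _] [hT _]] := generated_gens R.
apply: smallest_sub; last first.
  by move=> _ [[[[->|->]|->]|->]|->];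
    [exists (I0 R)|exists (R1 R)|exists (R2 R)|exists (R3 R)|exists (T R)].
apply/group_closedP; split=> [|_ _ [A OA <-] [B OB <-]|_ [A OA <-]].
- by exists 1%g => //; exact: over_O7_1.
- exists (A * B)%g; first exact: over_O7_M.
  by rewrite -PU21_mulE.
- exists A^-1%g; first exact: over_O7_V.
  by rewrite -PU21_invE.
Qed.
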